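(* For every $\varepsilon>0$ and every real $\rho>1$ there exist an integer $n$, a finite set $W\subset\{1,\rho,\rho^2,\dots\}$, and a probability distribution $D$ over the $n$-element subsets of $W$ such that, if an instance of the single secretary problem is drawn from $D$, every randomized algorithm (which may know $D$) accepts the maximum element of the instance with probability at most $\frac1e+\varepsilon$, the probability being over the choice of the instance, the uniformly random arrival order, and the algorithm's randomness.
   Context: Single secretary problem with $n$ items: an instance is a set of $n$ pairwise distinct positive reals presented one at a time in uniformly random order; the algorithm must irrevocably accept or reject each element upon arrival and may accept at most one. A randomized algorithm is given by probabilities $a_i(v_1,\dots,v_i)\in[0,1]$ of stopping and accepting $v_i$ at time $i$ given the sequence seen so far and not having stopped earlier. *)

(* Defs.v *)
From HB Require Import structures.
From mathcomp Require Import all_boot all_order all_algebra.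
From mathcomp Require Import all_classical all_reals all_analysis.
Set Implicit Arguments. Unset Strict Implicit. Unset Printing Implicit Defensive.
Import Order.TTheory GRing.Theory Num.Theory.
Local Open Scope ring_scope.

(* Ground set: the element with exponent k : 'I_K is rho^k.  A finite set
   W of powers of rho is encoded by its set of exponents W : {set 'I_K}. *)
Definition inst_vals (R : realType) (rho : R) (K : nat) (A : {set 'I_K}) : seq R :=
  [seq rho ^+ (val k) | k <- enum A].

(* An algorithm: alg (v_1,...,v_i) = probability of stopping and accepting v_i
   at time i, given the prefix seen so far and not having stopped before. *)
Definition stop_prob (R : realType) (alg : seq R -> R) (t : seq R) (i : nat) : R :=
  alg (take i.+1 t) * \prod_(j < i) (1 - alg (take j.+1 t)).

Definition is_max_at (R : realType) (t : seq R) (i : nat) : bool :=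
  all (fun x => x <= nth 0 t i) t.

Definition succ_order (R : realType) (alg : seq R -> R) (t : seq R) : R :=
  \sum_(i < size t) (if is_max_at t i then stop_prob alg t i else 0).

Definition succ_instance (R : realType) (alg : seq R -> R) (s : seq R) : R :=
  (size (permutations s))%:R^-1 * \sum_(t <- permutations s) succ_order alg t.

Definition success_prob (R : realType) (rho : R) (K : nat)
    (D : {ffun {set 'I_K} -> R}) (alg : seq R -> R) : R :=
  \sum_(A : {set 'I_K}) D A * succ_instance alg (inst_vals rho A).

Definition dist_on_nsubsets (R : realType) (K n : nat) (W : {set 'I_K})
    (D : {ffun {set 'I_K} -> R}) : Prop :=
  [/\ forall A, 0 <= D A,
      \sum_(A : {set 'I_K}) D A = 1
    & forall A, D A != 0 -> A \subset W /\ #|A| = n].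

Definition valid_alg (R : realType) (alg : seq R -> R) : Prop :=
  forall s, 0 <= alg s <= 1.

(* Main.v *)
(* The random instance A has weight proportional to 1 / (n C(M+1, n)), where M
   is the largest exponent in A and M < K.  Truncation at K apart, this law is
   self-similar: a prefix of i distinct exponents with maximum m has weight
   1 / (i (m+1)_i), falling factorial in the denominator.  Hence, whatever the
   values seen so far, the next item is a record with probability at most
   about 1/(i+1), and a record at time i is the overall maximum with
   probability at most i/n, so that the values carry no information beyond the
   relative ranks.

   Dynamic programming then bounds the gain of every algorithm by the value of
   the classical secretary problem, for which i |-> V(i/n) + 1/n is a
   supersolution, with V(x) = 1/e for x <= 1/e and V(x) = - x ln x beyond.
   Normalizing the weights costs a factor H_K / (H_K - H_{n-1}) of harmonic
   numbers, which tends to 1 as K grows. *)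
Require Import Defs.
From HB Require Import structures.
From mathcomp Require Import all_boot all_order all_algebra.
From mathcomp Require Import all_classical all_reals all_analysis.
From mathcomp Require Import ring lra zify.
Import Order.TTheory GRing.Theory Num.Theory.
Local Open Scope ring_scope.

(** * The limiting value function and its discrete Bellman inequality *)

Section Value.
Context {R : realType}.
Implicit Types a x : R.

Lemma ln_le_subr1 x : 0 < x -> ln x <= x - 1.
Proof.
move=> x0; rewrite -{1}[x](addrNK 1) [x - 1 + 1]addrC.
by apply: le_ln1Dx; rewrite ltrBrDl addrN.
Qed.

(* The limit, as the number of items grows, of the optimal continuation value
   of the classical problem at relative time [x]. *)
Definition limit_value x : R :=
  if x <= (expR 1)^-1 then (expR 1)^-1 else - (x * ln x).

(** This is [ln y <= y - 1] at [y = 1 / (x e)], multiplied by [x]. *)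
Lemma oppr_mul_ln_le x : 0 < x -> - (x * ln x) <= (expR 1)^-1.
Proof.
move=> x0; have e0 : 0 < expR 1 :> R := expR_gt0 1.
have xe0 : 0 < (x * expR 1)^-1 by rewrite invr_gt0 mulr_gt0.
have := ln_le_subr1 _ xe0.
rewrite lnV ?posrE ?mulr_gt0// lnM ?posrE// expRK => h.
have := ler_wpM2l (ltW x0) h.
rewrite invfM mulrBr mulrA divff ?gt_eqF//; lra.
Qed.

Lemma limit_value_ge x : 0 < x -> - (x * ln x) <= limit_value x.
Proof. by move=> x0; rewrite /limit_value; case: ifP => // _; exact: oppr_mul_ln_le. Qed.

Lemma limit_value_le x : 0 < x -> limit_value x <= (expR 1)^-1.
Proof. by move=> x0; rewrite /limit_value; case: ifP => // _; exact: oppr_mul_ln_le. Qed.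

Lemma limit_value_ge0 x : x <= 1 -> 0 <= limit_value x.
Proof.
move=> x1; rewrite /limit_value; case: ifP => [_|/negbT].
  by rewrite invr_ge0 expR_ge0.
rewrite -ltNge => /(lt_trans _) x0.
have {}x0 : 0 < x by apply: x0; rewrite invr_gt0 expR_gt0.
by rewrite -mulrN mulr_ge0 ?(ltW x0)// oppr_ge0 ln_le0.
Qed.

Lemma limit_value_nincr a x : 0 < a -> a <= x -> limit_value x <= limit_value a.
Proof.
move=> a0 ax; have x0 : 0 < x := lt_le_trans a0 ax.
have [ale|altn] := leP a (expR 1)^-1.
  by rewrite {2}/limit_value ale; exact: limit_value_le.
rewrite /limit_value (leNgt x) (lt_le_trans altn ax)/= (leNgt a) altn/=.
have e0 : 0 < expR 1 :> R := expR_gt0 1.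
(* Beyond 1/e the derivative [- (1 + ln x)] is nonpositive; the tangent bound on [ln (a / x)]
   replaces the calculus and leaves the defect [(x - a) (1 + ln a)]. *)
have lna : -1 <= ln a.
  by rewrite -[X in X <= _](expRK (-1)) ler_ln ?posrE ?expR_gt0// expRN ltW.
have h : ln (a / x) <= a / x - 1 by apply: ln_le_subr1; rewrite divr_gt0.
rewrite ln_div ?posrE// in h.
have := ler_wpM2l (ltW x0) h.
rewrite !mulrBr mulrCA divff ?gt_eqF// !mulr1 => h1.
have h2 : 0 <= (x - a) * (1 + ln a) by apply: mulr_ge0; lra.
nra.
Qed.

(** Beyond 1/e, V(x)/x is [- ln x], so division by [a x] turns the claim into
    [ln (a / x) <= a / x - 1]. When [x] is at most 1/e, V is constant and the defect is
    [(x - a) (1/e - a)]. *)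
Lemma limit_value_step a x : 0 < a -> a <= x ->
  a * (limit_value x + (x - a)) <= x * limit_value a.
Proof.
move=> a0 ax; have x0 : 0 < x := lt_le_trans a0 ax.
have [xle|xlt] := leP x (expR 1)^-1.
  rewrite /limit_value xle (le_trans ax xle).
  have h : 0 <= (x - a) * ((expR 1)^-1 - a) by apply: mulr_ge0; lra.
  nra.
apply: (@le_trans _ _ (x * - (a * ln a))); last first.
  by rewrite ler_pM2l// limit_value_ge.
rewrite /limit_value (leNgt x) xlt/=.
have h : ln (a / x) <= a / x - 1 by apply: ln_le_subr1; rewrite divr_gt0.
rewrite ln_div ?posrE// in h.
have := ler_wpM2l (ltW (mulr_gt0 a0 x0)) h.
have -> : a * x * (a / x - 1) = a * a - a * x by field; rewrite gt_eqF.
nra.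
Qed.

Definition value_bound (n i : nat) : R := limit_value (i%:R / n%:R) + n%:R^-1.

Lemma value_bound_ge0 n i : (i <= n)%N -> 0 <= value_bound n i.
Proof.
move=> ile; apply: addr_ge0; last by rewrite invr_ge0.
apply: limit_value_ge0; case: n ile => [|n] ile; first by rewrite invr0 mulr0.
by rewrite ler_pdivrMr// mul1r ler_nat.
Qed.

(** Bellman inequality of the classical problem: item i+1 is a record with probability 1/(i+1), and
    accepting it then wins with probability (i+1)/n. If continuing is better, monotonicity of V
    suffices; otherwise the slack 1/n in [value_bound] is exactly the increment [x - a] of
    [limit_value_step]. *)
Lemma value_bound_step n i : (0 < i)%N -> (i < n)%N ->
  i%:R / i.+1%:R * value_bound n i.+1 +
  i.+1%:R^-1 * Num.max (i.+1%:R / n%:R) (value_bound n i.+1) <= value_bound n i.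
Proof.
move=> i0 iltn; have n0 : 0 < n%:R :> R by rewrite ltr0n (leq_ltn_trans _ iltn).
have i1 : 0 < i.+1%:R :> R by [].
have ii0 : 0 < i%:R :> R by rewrite ltr0n.
have a0 : 0 < i%:R / n%:R :> R by rewrite divr_gt0.
have ax : i%:R / n%:R <= i.+1%:R / n%:R :> R by rewrite ler_pM2r ?invr_gt0// ler_nat.
have hm := limit_value_nincr _ _ a0 ax.
have hs := limit_value_step _ _ a0 ax.
rewrite /value_bound; set v := limit_value (i.+1%:R / n%:R) in hm hs *.
set u := limit_value (i%:R / n%:R) in hm hs *.
have e1 : i.+1%:R = i%:R + 1 :> R by rewrite -natr1.
rewrite /Num.max; case: ifP => _.
- have -> : i%:R / i.+1%:R * (v + n%:R^-1) + i.+1%:R^-1 * (v + n%:R^-1) = v + n%:R^-1.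
    by rewrite e1; field; rewrite -e1 !gt_eqF.
  by rewrite lerD2r.
- have -> : i.+1%:R^-1 * (i.+1%:R / n%:R) = n%:R^-1 :> R.
    by rewrite mulrA mulVf ?mul1r// gt_eqF.
  rewrite lerD2r mulrAC ler_pdivrMr// [u * _]mulrC.
  have := ler_wpM2l (ltW n0) hs.
  have -> : n%:R * (i%:R / n%:R * (v + (i.+1%:R / n%:R - i%:R / n%:R))) = i%:R * (v + n%:R^-1).
    by rewrite e1; field; rewrite gt_eqF.
  suff -> : n%:R * (i.+1%:R / n%:R * u) = i.+1%:R * u by [].
  by field; rewrite gt_eqF.
Qed.

End Value.

(** * The self-similar weights of prefixes *)

Section Weight.
Context {R : realType}.

(* Up to normalization and truncation at [K], the probability that the first [i]
   exponents presented are a given sequence with maximum [m - 1]. *)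
Definition weight (i m : nat) : R := (i%:R * (m ^_ i)%:R)^-1.

Lemma weight_ge0 i m : 0 <= weight i m.
Proof. by rewrite invr_ge0 mulr_ge0. Qed.

(** Total mass of the extensions by one of the [m - i] unseen exponents below the maximum, that is,
    of the non-records. *)
Lemma weight_below i m : (0 < i)%N ->
  (m - i)%:R * weight i.+1 m <= i%:R / i.+1%:R * weight i m.
Proof.
move=> i0; rewrite /weight ffactnSr natrM.
have [->|d0] := posnP (m - i)%N.
  by rewrite mul0r mulr_ge0 ?divr_ge0// invr_ge0 mulr_ge0.
have d0' : (m - i)%:R != 0 :> R by rewrite pnatr_eq0 -lt0n.
have f0 : (m ^_ i)%:R != 0 :> R by rewrite pnatr_eq0 -lt0n ffact_gt0; lia.
have i0' : i%:R != 0 :> R by rewrite pnatr_eq0 -lt0n.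
rewrite le_eqVlt; apply/orP; left; apply/eqP; field.
by rewrite f0 d0' i0' nat1r pnatr_eq0.
Qed.

Lemma weight_telescope i x : (0 < i)%N -> (i <= x)%N ->
  weight i.+1 x.+1 = i.+1%:R^-1 * (weight i x - weight i x.+1).
Proof.
move=> i0 ix.
have e : ((x.+1 ^_ i) * (x.+1 - i) = x.+1 * x ^_ i)%N by rewrite -ffactnSr ffactnS.
have {}e : (x.+1 ^_ i)%:R * (x.+1%:R - i%:R) = x.+1%:R * (x ^_ i)%:R :> R.
  by rewrite -natrB ?(leqW ix)// -!natrM e.
rewrite /weight ffactnS/= natrM.
have f0 : (x ^_ i)%:R != 0 :> R by rewrite pnatr_eq0 -lt0n ffact_gt0.
have g0 : (x.+1 ^_ i)%:R != 0 :> R by rewrite pnatr_eq0 -lt0n ffact_gt0 leqW.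
have i0' : i%:R != 0 :> R by rewrite pnatr_eq0 -lt0n.
have i1 : i.+1%:R != 0 :> R by rewrite pnatr_eq0.
have x1 : x.+1%:R != 0 :> R by rewrite pnatr_eq0.
move: e i1 x1 f0 g0 i0'; set F := (x ^_ i)%:R; set G := (x.+1 ^_ i)%:R.
set X := x.+1%:R; set I := i%:R; set J := i.+1%:R.
clearbody F G X I J => e J0 X0 F0 G0 I0.
(* Clearing denominators reduces the identity to [G * I = X * G - X * F], which is [e]. *)
apply: (mulfI (mulf_neq0 (mulf_neq0 (mulf_neq0 J0 X0) (mulf_neq0 F0 G0)) I0)).
transitivity (G * I); first by field; rewrite ?J0 ?X0 ?F0 ?G0 ?I0.
transitivity (X * G - X * F); last by field; rewrite ?J0 ?X0 ?F0 ?G0 ?I0.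
by rewrite -e; ring.
Qed.

(** Total mass of the extensions by a record. The sum telescopes, and the term at the truncation
    point [K] is dropped because it only lowers the mass. *)
Lemma weight_above i m K : (0 < i)%N -> (i <= m)%N ->
  \sum_(m <= x < K) weight i.+1 x.+1 <= i.+1%:R^-1 * weight i m.
Proof.
move=> i0 im; have [Km|mK] := leqP K m.
  by rewrite big_geq// mulr_ge0// weight_ge0.
rewrite (eq_big_nat _ _ (F2 := fun x => - (i.+1%:R^-1 * weight i x.+1)
    - - (i.+1%:R^-1 * weight i x))); last first.
  move=> x /andP[mx _]; rewrite weight_telescope// ?(leq_trans im)//; ring.
rewrite telescope_sumr ?(ltnW mK)// opprK addrC lerBlDr lerDl.
by rewrite mulr_ge0// weight_ge0.
Qed.

(** The falling factorial counts the ways to complete a prefix of i+1 exponents with maximum [x] by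
    [k] distinct smaller ones. With n = i+k+1 items, a record at time i+1 thus stays the maximum
    with probability at most (i+1)/n. *)
Lemma weight_split k i x :
  ((x - i) ^_ k)%:R * weight (i + k).+1 x.+1 <=
  i.+1%:R / (i + k).+1%:R * weight i.+1 x.+1.
Proof.
rewrite /weight -addSn.
have e : (x.+1 ^_ (i.+1 + k) = x.+1 ^_ i.+1 * (x - i) ^_ k)%N.
  elim: k => [|k IH]; first by rewrite addn0 ffactn0 muln1.
  by rewrite addnS (ffactnSr _ (i.+1 + k)) (ffactnSr (x - i)) IH -mulnA; congr (_ * (_ * _))%N; lia.
rewrite e natrM.
have [->|d0] := posnP ((x - i) ^_ k)%N.
  by rewrite mul0r !mulr_ge0// ?invr_ge0// mulr_ge0.
have [f0|f0] := posnP (x.+1 ^_ i.+1)%N.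
  by rewrite f0 !(mul0r, mulr0, invr0).
have d0' : ((x - i) ^_ k)%:R != 0 :> R by rewrite pnatr_eq0 -lt0n.
have f0' : (x.+1 ^_ i.+1)%:R != 0 :> R by rewrite pnatr_eq0 -lt0n.
have i1 : i.+1%:R != 0 :> R by rewrite pnatr_eq0.
have n1 : (i.+1 + k)%:R != 0 :> R by rewrite pnatr_eq0.
move: d0' f0' i1 n1; set F := (_ ^_ k)%:R; set G := (_ ^_ _)%:R.
set I := i.+1%:R; set N := (_ + _)%:R.
clearbody F G I N => F0 G0 I0 N0.
by rewrite le_eqVlt; apply/orP; left; apply/eqP; field; rewrite ?F0 ?G0 ?I0 ?N0.
Qed.

End Weight.

(** * Maxima of exponent sequences and counts of unseen exponents *)

Section Top.
Context {K : nat}.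
Implicit Types (s : seq 'I_K) (x : 'I_K).

(* One more than the maximum, so that the empty sequence has [top] equal to 0. *)
Definition top s : nat := \max_(y <- s) y.+1.

Lemma top_rcons s x : top (rcons s x) = maxn (top s) x.+1.
Proof. by rewrite /top -cats1 big_cat big_seq1. Qed.

Lemma mem_ltn_top s x : x \in s -> (x < top s)%N.
Proof. by move=> xs; exact: (@leq_bigmax_seq _ s xpredT (fun y : 'I_K => y.+1) x xs isT). Qed.

Lemma top_leP s m : reflect (forall x, x \in s -> (x < m)%N) (top s <= m)%N.
Proof.
apply: (iffP (bigmax_leqP_seq _ _ _ _)) => h x xs; first exact: h.
by move=> _; exact: h.
Qed.

Lemma top_le_ord s : (top s <= K)%N.
Proof. by apply/top_leP => x _. Qed.

Lemma perm_top s t : perm_eq s t -> top s = top t.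
Proof. by move=> st; rewrite /top (perm_big t). Qed.

Lemma card_ltn_ord m : (m <= K)%N -> #|[pred y : 'I_K | (y < m)%N]| = m.
Proof.
move=> mK; rewrite -sum1_card -[RHS](card_ord m) -sum1_card.
by rewrite (big_ord_widen K (fun=> 1%N) mK).
Qed.

Lemma card_unseen_below s m : uniq s -> (top s <= m)%N -> (m <= K)%N ->
  #|[pred y : 'I_K | (y \notin s) && (y < m)%N]| = (m - size s)%N.
Proof.
move=> us sm mK; have := cardID [in s] [pred y : 'I_K | (y < m)%N].
rewrite card_ltn_ord//.
have -> : #|[predI [pred y : 'I_K | (y < m)%N] & s]| = size s.
  rewrite -(card_uniqP us); apply: eq_card => y; rewrite !inE.
  by case ys: (y \in s); rewrite ?andbF// (leq_trans (mem_ltn_top _ _ ys) sm).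
move=> h; rewrite -[X in (X - _)%N]h addKn.
by apply: eq_card => y; rewrite !inE.
Qed.

Lemma size_le_top s : uniq s -> (size s <= top s)%N.
Proof.
move=> us; rewrite -(card_uniqP us) -[X in (_ <= X)%N](card_ltn_ord _ (top_le_ord s)).
by apply: subset_leq_card; apply/fintype.subsetP => y ys; rewrite inE mem_ltn_top.
Qed.

End Top.

(** * Dynamic programming on the unnormalized gain *)

Lemma sum_uniq_tupleS {R : realType} {K : nat} (k : nat) (s : seq 'I_K)
    (F : seq 'I_K -> R) :
  \sum_(w : k.+1.-tuple 'I_K | uniq (s ++ w)) F w =
  \sum_(x : 'I_K | x \notin s)
    \sum_(w : k.-tuple 'I_K | uniq (rcons s x ++ w)) F (x :: w).
Proof.
rewrite pair_big_dep/=.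
rewrite (reindex (fun p : 'I_K * k.-tuple 'I_K => [tuple of p.1 :: p.2]))/=; last first.
  exists (fun t => (thead t, [tuple of behead t])).
    by move=> [x w] _; congr (_, _); apply: val_inj.
  by move=> t _; rewrite [RHS]tuple_eta.
apply: eq_bigl => -[x w]/=; rewrite cat_rcons andbC.
by case: (boolP (uniq _)) => //; rewrite -cat_rcons cat_uniq rcons_uniq => /andP[/andP[->]].
Qed.

Section Gain.
Context {R : realType} {K : nat} (alg : seq 'I_K -> R).
Context (alg01 : forall s, 0 <= alg s <= 1).

(* Probability of accepting the maximum of [s ++ w] when it is presented in
   this order and the algorithm has already rejected all of [s]. *)
Fixpoint gain (s w : seq 'I_K) : R :=
  if w is x :: w' then
    alg (rcons s x) * (all (fun y : 'I_K => y <= x)%N (s ++ w))%:R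
    + (1 - alg (rcons s x)) * gain (rcons s x) w'
  else 0.

(** Unnormalized continuation value after rejecting [s], with [k] items to come; it is to be
    compared with the mass [weight (size s) (top s)] of the prefix. *)
Definition total_gain (n k : nat) (s : seq 'I_K) : R :=
  \sum_(w : k.-tuple 'I_K | uniq (s ++ w)) weight n (top (s ++ w)) * gain s w.

Definition max_mass (n k : nat) (s : seq 'I_K) (x : 'I_K) : R :=
  \sum_(w : k.-tuple 'I_K | uniq (rcons s x ++ w))
    weight n (top (rcons s x ++ w)) *
    (all (fun y : 'I_K => y <= x)%N (s ++ x :: w))%:R.

Lemma total_gainS n k s :
  total_gain n k.+1 s = \sum_(x : 'I_K | x \notin s)
    (alg (rcons s x) * max_mass n k s x
     + (1 - alg (rcons s x)) * total_gain n k (rcons s x)).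
Proof.
rewrite /total_gain
  (sum_uniq_tupleS k s (fun w => weight n (top (s ++ w)) * gain s w)).
apply: eq_bigr => x _; rewrite /max_mass !mulr_sumr -big_split/=.
by apply: eq_bigr => w _; rewrite cat_rcons; ring.
Qed.

Lemma max_mass_below n k s (x : 'I_K) : (x < top s)%N -> max_mass n k s x = 0.
Proof.
move=> xs; apply: big1 => w; rewrite cat_uniq rcons_uniq => /andP[/andP[xns _] _].
case: (boolP (all _ _)); rewrite ?mulr0// all_cat => /andP[/allP h _].
exfalso; move: xs; rewrite ltnNge => /negP; apply; apply/top_leP => y ys.
by rewrite ltn_neqAle h// andbT; apply: contraNneq xns => /val_inj <-.
Qed.

(** The record [x] stays the maximum exactly when the rest is a duplicate-free tuple of unseen
    exponents below [x]. All these completions have the same weight, so counting them and applying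
    [weight_split] suffices. *)
Lemma max_mass_above n k s (x : 'I_K) : uniq s -> (top s <= x)%N ->
  n = (size s + k).+1 ->
  max_mass n k s x <= (size s).+1%:R / n%:R * weight (size s).+1 x.+1.
Proof.
move=> us sx ->.
have xs : x \notin s by apply/negP => /mem_ltn_top; rewrite ltnNge sx.
pose A : pred 'I_K := [pred y | (y \notin s) && (y < x)%N].
rewrite /max_mass (eq_bigr (fun w : k.-tuple 'I_K =>
   if all A w && uniq w then weight (size s + k).+1 x.+1 else 0)); last first.
  move=> w; rewrite cat_rcons => uw.
  have -> : all (fun y : 'I_K => y <= x)%N (s ++ x :: w) = all A w && uniq w.
    move: (uw); rewrite cat_uniq us/= => /andP[/norP[_ /hasPn sw] /andP[xw ->]].
    rewrite andbT all_cat/= leqnn/=; apply/andP/allP => [[_ /allP h] y yw|h].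
      rewrite /A inE (sw _ yw) ltn_neqAle h// andbT.
      by apply: contraNneq xw => /val_inj <-.
    split; apply/allP => y ys; first by apply: ltnW; apply: (leq_trans (mem_ltn_top _ _ ys)).
    by have /andP[_ /ltnW] := h _ ys.
  case: ifP => [/andP[/allP h _]|_]; rewrite ?mulr1 ?mulr0//; congr weight.
  apply/eqP; rewrite eqn_leq; apply/andP; split.
    apply/top_leP => y; rewrite mem_cat inE => /or3P[ys|/eqP->//|yw].
      by rewrite ltnS ltnW// (leq_trans (mem_ltn_top _ _ ys)).
    by have /andP[_ /ltnW] := h _ yw.
  by apply: mem_ltn_top; rewrite mem_cat inE eqxx orbT.
rewrite -big_mkcondr/= sumr_const.
rewrite (_ : #|_| = (x - size s) ^_ k)%N; last first.
  rewrite -(card_unseen_below s x us sx (ltnW (ltn_ord x))) -card_uniq_tuples.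
  apply: eq_card => w; rewrite inE unfold_in; apply: andb_idl => /andP[/allP h uw].
  rewrite cat_rcons cat_uniq us/= uw andbT negb_or xs/=; apply/andP; split.
    by apply/hasPn => y yw; have /andP[] := h _ yw.
  by apply/negP => /h /andP[_]; rewrite ltnn.
by apply: le_trans (weight_split k (size s) x); rewrite mulr_natl.
Qed.

(** An item below [top s] cannot be the maximum, so only the continuation counts. For a record, the
    randomized decision is a convex combination of accepting and continuing, hence at most the
    better of the two. *)
Lemma total_gain_step n k s b : uniq s -> n = (size s + k).+1 -> 0 <= b ->
  (forall x, x \notin s ->
     total_gain n k (rcons s x) <= weight (size s).+1 (top (rcons s x)) * b) ->
  total_gain n k.+1 s <=
    (top s - size s)%:R * weight (size s).+1 (top s) * b
    + \sum_(top s <= x < K) weight (size s).+1 x.+1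
        * Num.max ((size s).+1%:R / n%:R) b.
Proof.
move=> us ns b0 hb; rewrite total_gainS.
have a0 s' : 0 <= alg s' by case/andP: (alg01 s').
have a1 s' : 0 <= 1 - alg s' by rewrite subr_ge0; case/andP: (alg01 s').
rewrite (bigID (fun x : 'I_K => x < top s)%N)/= lerD//.
  rewrite -(card_unseen_below s (top s))// ?top_le_ord//.
  rewrite -mulrA mulr_natl -sumr_const; apply: ler_sum => x /andP[xs xt].
  rewrite max_mass_below// mulr0 add0r.
  have w0 : 0 <= weight (size s).+1 (top s) * b by rewrite mulr_ge0// weight_ge0.
  have := hb _ xs; rewrite top_rcons (maxn_idPl xt) => h.
  apply: le_trans (ler_wpM2l (a1 _) h) _.
  by rewrite ler_piMl// lerBlDr lerDl.
rewrite big_geq_mkord/= (eq_bigl (fun x : 'I_K => (top s <= x)%N)); last first.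
  move=> x; rewrite -leqNgt; apply: andb_idl => xt.
  by apply/negP => /mem_ltn_top; rewrite ltnNge xt.
apply: ler_sum => x xt.
have xs : x \notin s by apply/negP => /mem_ltn_top; rewrite ltnNge xt.
have := hb _ xs; rewrite top_rcons (maxn_idPr (leqW xt)) => h.
have h' := max_mass_above n k s x us xt ns.
set M := Num.max _ _.
have w0 : 0 <= weight (size s).+1 x.+1 :> R := weight_ge0 _ _.
apply: (@le_trans _ _ (alg (rcons s x) * (weight (size s).+1 x.+1 * M) +
   (1 - alg (rcons s x)) * (weight (size s).+1 x.+1 * M))).
  apply: lerD; apply: ler_wpM2l => //.
    by apply: le_trans h' _; rewrite mulrC ler_wpM2l// /M le_max lexx.
  by apply: le_trans h _; rewrite ler_wpM2l// /M le_max lexx orbT.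
by rewrite -mulrDl addrC subrK mul1r.
Qed.

(** Backward induction: [weight_below] and [weight_above] supply the transition masses, and
    [value_bound_step] closes the step. *)
Lemma total_gain_le n k s : uniq s -> (0 < size s)%N -> n = (size s + k)%N ->
  total_gain n k s <= weight (size s) (top s) * value_bound n (size s).
Proof.
elim: k s => [|k IH] s us s0 ns.
  rewrite /total_gain big1 => [|w _]; last by rewrite (tuple0 w)/= mulr0.
  by rewrite mulr_ge0 ?weight_ge0// value_bound_ge0// ns leq_addr.
have b0 : 0 <= value_bound n (size s).+1 :> R by apply: value_bound_ge0; lia.
rewrite addnS in ns.
apply: le_trans (total_gain_step n k s _ us ns b0 _) _.
  move=> x xs; rewrite -(size_rcons s x); apply: IH; rewrite ?rcons_uniq ?xs//.
    by rewrite size_rcons.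
  by rewrite size_rcons ns addSn.
have w0 : 0 <= weight (size s) (top s) :> R := weight_ge0 _ _.
rewrite -mulr_suml.
set M := Num.max _ _.
have M0 : 0 <= M by rewrite /M le_max b0 orbT.
apply: le_trans (lerD (ler_wpM2r b0 (weight_below (size s) (top s) s0))
  (ler_wpM2r M0 (weight_above (size s) (top s) K s0 (size_le_top s us)))) _.
have iltn : (size s < n)%N by rewrite ns ltnS leq_addr.
have := ler_wpM2l w0 (value_bound_step n (size s) s0 iltn).
rewrite -/M; apply: le_trans; rewrite le_eqVlt; apply/orP; left; apply/eqP.
ring.
Qed.

(** The empty prefix is treated apart, since [weight 0 m] is the inverse of 0, hence 0. One step is
    unrolled: the first item is always a record, and exponent [x] has mass 1/(x+1). *)
Lemma total_gain_nil_le n : (0 < n)%N ->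
  total_gain n n [::] <= (\sum_(0 <= x < K) x.+1%:R^-1) * ((expR 1)^-1 + n%:R^-1).
Proof.
case: n => // n _.
have vb : value_bound n.+1 1 <= (expR 1)^-1 + n.+1%:R^-1 :> R.
  by rewrite lerD2r limit_value_le// divr_gt0.
have b0 : 0 <= value_bound n.+1 1 :> R by apply: value_bound_ge0.
apply: le_trans (total_gain_step n.+1 n [::] _ _ _ b0 _) _ => //.
  by move=> x _; apply: total_gain_le.
rewrite /= /top big_nil sub0n !mul0r add0r mulr_suml; apply: ler_sum => x _.
rewrite /weight ffactn1 mul1r ler_wpM2l ?invr_ge0// ge_max vb andbT mul1r lerDr.
by rewrite invr_ge0 expR_ge0.
Qed.

End Gain.

(** * From the success probability to gains over tuples of exponents *)

Lemma succ_order_gain {R : realType} {K : nat} (rho : R) (alg : seq R -> R)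
    (u : seq 'I_K) : 1 < rho ->
  succ_order alg [seq rho ^+ (val k) | k <- u] =
  gain (fun v => alg [seq rho ^+ (val k) | k <- v]) [::] u.
Proof.
move=> rho1; pose f (k : 'I_K) := rho ^+ (val k).
(* Generalized over the rejected prefix [s], so that induction on [w] follows the recursion of
   [gain]. *)
suff H s w : \sum_(i < size w) (if is_max_at (map f (s ++ w)) (size s + i)
    then alg (take (size s + i).+1 (map f (s ++ w))) *
      \prod_(j < i) (1 - alg (take (size s + j).+1 (map f (s ++ w)))) else 0)
    = gain (fun v => alg (map f v)) s w.
  by rewrite -(H [::] u) /succ_order size_map.
elim: w s => [|x w IH] s; first by rewrite big_ord0.
rewrite /= big_ord_recl/= big_ord0 mulr1 addn0.
have tk : take (size s).+1 (map f (s ++ x :: w)) = map f (rcons s x).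
  by rewrite -cat_rcons map_cat take_size_cat// size_map size_rcons.
congr (_ + _).
  have -> : is_max_at (map f (s ++ x :: w)) (size s) =
      all (fun y : 'I_K => y <= x)%N (s ++ x :: w).
    rewrite /is_max_at map_cat nth_cat size_map ltnn subnn/=.
    rewrite -[f x :: map f w]/(map f (x :: w)) -map_cat all_map; apply: eq_all => y /=.
    by rewrite /f ler_eXn2l.
  by rewrite tk; case: ifP; rewrite ?mulr1 ?mulr0.
rewrite -IH mulr_sumr; apply: eq_bigr => i _.
rewrite /bump/= add1n addnS -addSn size_rcons cat_rcons.
case: ifP => _; last by rewrite mulr0.
rewrite big_ord_recl/= addn0 tk mulrCA; congr (_ * (_ * _)).
by apply: eq_bigr => j _; rewrite /bump/= add1n addnS.
Qed.

Lemma perm_permutations_map (T U : eqType) (f : T -> U) (s : seq T) :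
  injective f -> uniq s ->
  perm_eq (map (map f) (permutations s)) (permutations (map f s)).
Proof.
move=> fI us; apply: uniq_perm; rewrite ?permutations_uniq//.
  by rewrite map_inj_uniq ?permutations_uniq//; exact: inj_map.
apply: (uniq_min_size _ _ _).2 => //.
- by rewrite map_inj_uniq ?permutations_uniq//; exact: inj_map.
- by move=> _ /mapP[t + ->]; rewrite !mem_permutations; exact: perm_map.
- by rewrite size_map !size_permutations ?map_inj_uniq// size_map.
Qed.

Lemma sum_permutations_enum {R : realType} {T : finType} (A : {set T})
    (F : seq T -> R) :
  \sum_(t <- permutations (enum A)) F t =
  \sum_(u : #|A|.-tuple T | uniq u && ([set x in u] == A)) F u.
Proof.
pose P := [pred u : #|A|.-tuple T | uniq u && ([set x in u] == A)].
transitivity (\sum_(t <- map val (enum P)) F t); last by rewrite big_map big_enum.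
apply: perm_big.
apply: uniq_perm; rewrite ?permutations_uniq//.
  by rewrite map_inj_uniq ?enum_uniq//; exact: val_inj.
move=> t; rewrite mem_permutations; apply/idP/mapP => [tA|[u]].
  have st : size t == #|A| by rewrite (perm_size tA) -cardE.
  exists (Tuple st) => //; rewrite mem_enum unfold_in/= (perm_uniq tA) enum_uniq/=.
  by apply/eqP/setP => x; rewrite inE (perm_mem tA) mem_enum.
rewrite mem_enum unfold_in => /andP[uu /eqP uA] ->.
apply: uniq_perm; rewrite ?enum_uniq// => x.
by move/setP: uA => /(_ x); rewrite mem_enum inE.
Qed.

Lemma success_prob_tuples {R : realType} {K n : nat} (rho : R)
    (D : {ffun {set 'I_K} -> R}) (alg : seq R -> R) : 1 < rho ->
  (forall A, D A != 0 -> #|A| = n) ->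
  success_prob rho D alg = \sum_(u : n.-tuple 'I_K | uniq u)
    D [set x in u] * (n`!)%:R^-1 *
    gain (fun v => alg [seq rho ^+ (val k) | k <- v]) [::] u.
Proof.
move=> rho1 Dn; have rho0 : 0 < rho := lt_trans ltr01 rho1.
pose f (k : 'I_K) := rho ^+ (val k).
have fI : injective f.
  by move=> x y /(ieexprIn rho0 (negbT (gt_eqF rho1))) /val_inj.
rewrite [RHS](partition_big (fun u : n.-tuple 'I_K => [set x in u]) xpredT)//=.
(* Sets of zero mass may have any cardinality; both sides vanish there. *)
apply: eq_bigr => A _; have [DA|DA] := eqVneq (D A) 0.
  by rewrite DA mul0r big1// => u /andP[_ /eqP->]; rewrite DA !mul0r.
have <- := Dn _ DA.
rewrite /succ_instance/inst_vals size_permutations ?map_inj_uniq ?enum_uniq//.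
rewrite size_map -cardE mulrA -(perm_big _ (perm_permutations_map _ _ f _ fI (enum_uniq A))).
rewrite big_map (sum_permutations_enum A (fun t => succ_order alg (map f t))) mulr_sumr.
by apply: eq_bigr => u /andP[_ /eqP ->]; rewrite succ_order_gain.
Qed.

(** * The law on n-sets and its normalizing constant *)

Section Normalization.
Context {R : realType}.

Definition set_weight (K n : nat) (A : {set 'I_K}) : R :=
  (n%:R * 'C(top (enum A), n)%:R)^-1.

Definition norm_const (K n : nat) : R :=
  \sum_(A : {set 'I_K} | #|A| == n) set_weight K n A.

Lemma set_weight_ge0 K n A : 0 <= set_weight K n A.
Proof. by rewrite invr_ge0 mulr_ge0. Qed.

(** Subtracting the n-sets with [top] at most N from those with [top] at most N+1 gives the count by
    Pascal's rule. *)
Lemma card_sets_top K n N : (0 < n)%N -> (N < K)%N ->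
  #|[set A : {set 'I_K} | (#|A| == n) && (top (enum A) == N.+1)]| = 'C(N, n.-1).
Proof.
move=> n0 NK; pose L m := [set A : {set 'I_K} | (#|A| == n) && (top (enum A) <= m)%N].
have cL m : (m <= K)%N -> #|L m| = 'C(m, n).
  move=> mK; have := cards_draws [set y : 'I_K | (y < m)%N] n.
  rewrite [X in 'C(X, _)]cardsE card_ltn_ord// => <-.
  apply: eq_card => A; rewrite !inE andbC; congr (_ && _).
  apply/top_leP/fintype.subsetP => h x; rewrite ?mem_enum => xA.
    by rewrite inE; apply: h; rewrite mem_enum.
  by have := h x xA; rewrite inE.
have -> : [set A : {set 'I_K} | (#|A| == n) && (top (enum A) == N.+1)] = L N.+1 :\: L N.
  apply/finset.setP => A; rewrite !inE; case: (#|A| == n) => //=; rewrite -ltnNge.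
  by rewrite eqn_leq andbC.
rewrite cardsD (finset.setIidPr _); last first.
  by apply/fintype.subsetP => A; rewrite !inE => /andP[-> /leqW].
rewrite !cL ?(ltnW NK)//; case: n n0 {L cL} => // n _.
by rewrite binS addKn.
Qed.

(** Grouped by largest exponent N, the C(N, n-1) sets weigh 1/(n C(N+1, n)) each, and
    [(N+1) C(N, n-1) = n C(N+1, n)] makes each group contribute 1/(N+1). *)
Lemma norm_const_ge K n : (0 < n)%N ->
  \sum_(n.-1 <= N < K) N.+1%:R^-1 <= norm_const K n.
Proof.
move=> n0; rewrite /norm_const.
rewrite (partition_big (fun A : {set 'I_K} => inord (top (enum A)) : 'I_K.+1) xpredT)//=.
(* The class of [top] 0 is split off; index N then stands for [top] equal to N+1. *)
rewrite big_ord_recl/=.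
rewrite -[X in X <= _]add0r lerD//; first by apply: sumr_ge0 => A _; exact: set_weight_ge0.
rewrite big_geq_mkord/= [X in _ <= X](bigID (fun N : 'I_K => n.-1 <= N)%N)/=.
rewrite -[X in X <= _]addr0 lerD//; last first.
  by apply: sumr_ge0 => N _; apply: sumr_ge0 => A _; exact: set_weight_ge0.
apply: ler_sum => N nN.
rewrite (eq_bigl [in [set A : {set 'I_K} | (#|A| == n) && (top (enum A) == N.+1)]]); last first.
  move=> A; rewrite inE; congr (_ && _).
  by rewrite -val_eqE/= inordK ?ltnS ?top_le_ord// /bump.
rewrite (eq_bigr (fun=> (n%:R * 'C(N.+1, n)%:R)^-1)); last first.
  by move=> A; rewrite inE /set_weight => /andP[_ /eqP->].
rewrite sumr_const card_sets_top//.
rewrite le_eqVlt; apply/orP; left; apply/eqP.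
case: n n0 nN => // n _ nN /=.
have e : (N.+1 * 'C(N, n) = n.+1 * 'C(N.+1, n.+1))%N by rewrite mul_bin_diag.
have c0 : 'C(N, n)%:R != 0 :> R by rewrite pnatr_eq0 -lt0n bin_gt0.
by rewrite -natrM -e natrM -[RHS]mulr_natr invfM -mulrA mulVf// mulr1.
Qed.

(** A uniform arrival order divides by n!, which turns the binomial into a falling factorial: full
    sequences follow [weight]. *)
Lemma weight_set_weight K n (u : n.-tuple 'I_K) : uniq u ->
  set_weight K n [set x in u] * (n`!)%:R^-1 = weight n (top u).
Proof.
move=> uu; rewrite /set_weight /weight -bin_ffact natrM (perm_top _ u).
  by rewrite -invfM mulrA.
by apply: uniq_perm; rewrite ?enum_uniq// => x; rewrite mem_enum inE.
Qed.

End Normalization.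

(** * Harmonic divergence and the choice of the parameters *)

Lemma harmonic_tail_unbounded {R : realType} (m : nat) (M : R) :
  exists2 K, (m <= K)%N & M <= \sum_(m <= x < K) x.+1%:R^-1.
Proof.
(* Otherwise the nondecreasing harmonic partial sums would be bounded, hence convergent. *)
apply: contrapT => noK; apply: (@dvg_harmonic R).
pose P : R := \sum_(0 <= x < m) x.+1%:R^-1.
have nd : nondecreasing_seq (series (@harmonic R)).
  by apply: nondecreasing_series => k _ _; exact: harmonic_ge0.
apply: (nondecreasing_is_cvgn nd); exists (P + M) => _ [K _ <-].
apply: (le_trans (nd _ _ (leq_maxr m K))).
rewrite /series/= (@big_cat_nat _ _ _ m)//= ?leq_maxl// lerD2l leNgt.
apply/negP => /ltW h; apply: noK; exists (maxn m K) => //.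
exact: leq_maxl.
Qed.

Theorem theorem5p6 (R : realType) (eps rho : R) :
  0 < eps -> 1 < rho ->
  exists (n K : nat) (W : {set 'I_K}) (D : {ffun {set 'I_K} -> R}),
    (0 < n)%N /\ dist_on_nsubsets n W D /\
    forall alg : seq R -> R, valid_alg alg ->
      success_prob rho D alg <= (expR 1)^-1 + eps.
Proof.
move=> eps0 rho1.
have [n [n0 neps]] : exists n, (0 < n)%N /\ n%:R^-1 < eps.
  exists (Num.truncn eps^-1).+1; split => //.
  by rewrite invf_plt ?posrE// truncnS_gt.
pose a : R := (expR 1)^-1 + n%:R^-1.
pose P : R := \sum_(0 <= x < n.-1) x.+1%:R^-1.
(* The gain is at most [(P + S) * a] before normalization, with [S] the tail sum from [n.-1] to [K].
   As [eps - 1/n] is [(1/e + eps) - a], the second bound on [S] gives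
   [(P + S) * a <= S * (1/e + eps)]; the bound 1 makes the normalizing constant positive. *)
have [K nK hK] := harmonic_tail_unbounded n.-1 (Num.max 1 (P * a / (eps - n%:R^-1))).
have SZ := @norm_const_ge R K n n0.
set S := \sum_(_ <= _ < _) _ in hK SZ.
move: hK; rewrite ge_max => /andP[S1 hS].
have Z0 : 0 < norm_const K n :> R by lra.
pose D : {ffun {set 'I_K} -> R} := [ffun A : {set 'I_K} =>
  if #|A| == n then (norm_const K n)^-1 * set_weight K n A else 0].
exists n, K, [set: 'I_K], D; split => //; split.
  split=> [A||A]; rewrite /D.
  - rewrite ffunE; case: ifP => // _.
    by rewrite mulr_ge0 ?set_weight_ge0// invr_ge0 ltW.
  - under eq_bigr do rewrite ffunE.
    by rewrite -big_mkcond/= -mulr_sumr mulVf// gt_eqF.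
  - by rewrite ffunE; case: (#|A| =P n) => [-> _|]; rewrite ?eqxx.
move=> alg algP; rewrite (@success_prob_tuples R K n)//; last first.
  by move=> A; rewrite /D ffunE; case: (#|A| =P n); rewrite ?eqxx.
rewrite (eq_bigr (fun u : n.-tuple 'I_K => (norm_const K n)^-1 * (weight n (top u) *
   gain (fun v => alg [seq rho ^+ (val k) | k <- v]) [::] u))); last first.
  move=> u uu; rewrite /D ffunE.
  have -> : #|[set x in u]| = n by rewrite cardsE (card_uniqP uu) size_tuple.
  by rewrite eqxx -(weight_set_weight K n)// !mulrA.
rewrite -mulr_sumr mulrC ler_pdivrMr//.
have := @total_gain_nil_le R K (fun v => alg [seq rho ^+ (val k) | k <- v])
  (fun v => algP _) n n0.
move=> /le_trans; apply.
rewrite -/a (@big_cat_nat _ _ _ n.-1)//= -/P -/S.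
move: hS; rewrite ler_pdivrMr ?subr_gt0// => hS.
have e0 : 0 < (expR 1)^-1 :> R by rewrite invr_gt0 expR_gt0.
have : S * ((expR 1)^-1 + eps) <= norm_const K n * ((expR 1)^-1 + eps).
  by rewrite ler_wpM2r// addr_ge0// ltW.
rewrite /a in hS *; lra.
Qed.
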